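(* The set $$\{\vartheta\in\mathbb R^n : d_1(\vartheta-\mathbf 1,\mathbb Z^n_o)>1\}$$ is non-empty for $n\ge 3$ and connected for $n\ge 4$. The same holds for the subset $$\Big\{\vartheta\in\mathbb R^n : d_1(\vartheta-\mathbf 1,\mathbb Z^n_o)>1,\ \vartheta_i>0\ \text{for all } i,\ \sum_{i=1}^n(\vartheta_i-1)>-2\Big\},$$ i.e. it is non-empty for $n\ge3$ and connected for $n\ge4$.
   Context: $\mathbf 1=(1,\dots,1)\in\mathbb R^n$; $d_1$ is the standard $\ell^1$ distance and $\|\cdot\|_1$ the $\ell^1$ norm on $\mathbb R^n$; $\mathbb Z^n_o$ is the set of $m\in\mathbb Z^n$ with $\|m\|_1$ odd; $d_1(v,\mathbb Z^n_o)=\inf_{m\in\mathbb Z^n_o}d_1(v,m)$. *)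

(* Defs.v *)
From mathcomp Require Import all_boot all_order all_algebra.
From mathcomp Require Import all_classical all_reals all_analysis.

Set Implicit Arguments.
Unset Strict Implicit.
Unset Printing Implicit Defensive.

Import Order.TTheory GRing.Theory Num.Theory.
Import numFieldNormedType.Exports.

Local Open Scope classical_set_scope.
Local Open Scope ring_scope.

(* Kept generic in K so that it applies to both real and integer vectors. *)
Definition l1norm (K : numDomainType) (n : nat) (v : 'rV[K]_n) : K :=
  \sum_(i < n) `|v ord0 i|.

Definition d1 (R : realType) (n : nat) (v w : 'rV[R]_n) : R := l1norm (v - w).

(* [inf] is the infimum in R; it takes the junk value 0 when A is empty. *)
Definition d1_set (R : realType) (n : nat) (v : 'rV[R]_n) (A : set 'rV[R]_n)
  : R := inf [set d1 v m | m in A].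

Definition oddZn (n : nat) : set 'rV[int]_n :=
  [set m | odd `|l1norm m|%N].
Arguments oddZn n _ : clear implicits.

Definition Zodd (R : realType) (n : nat) : set 'rV[R]_n :=
  [set map_mx intr m | m in oddZn n].
Arguments Zodd R n _ : clear implicits.

Definition far_set (R : realType) (n : nat) : set 'rV[R]_n :=
  [set theta | 1 < d1_set (theta - const_mx 1) (Zodd R n)].
Arguments far_set R n _ : clear implicits.

Definition far_pos_set (R : realType) (n : nat) : set 'rV[R]_n :=
  [set theta | [/\ 1 < d1_set (theta - const_mx 1) (Zodd R n),
                   (forall i : 'I_n, 0 < theta ord0 i) &
                   -2 < \sum_(i < n) (theta ord0 i - 1)]].
Arguments far_pos_set R n _ : clear implicits.

(* Main.v *)
Require Import Defs.
From mathcomp Require Import all_boot all_order all_algebra.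
From mathcomp Require Import all_classical all_reals all_analysis.
From mathcomp Require Import ring lra zify.

Set Implicit Arguments.
Unset Strict Implicit.
Unset Printing Implicit Defensive.

Import Order.TTheory GRing.Theory Num.Theory.
Import numFieldNormedType.Exports.

Local Open Scope classical_set_scope.
Local Open Scope ring_scope.

(** Put x = theta - 1, and cut R^n into the unit cubes a + [0,1]^n with a in
    Z^n. On one cube every coordinate of x - m has constant sign when m is an
    integer vector, so x |-> d1 x m is affine there and the distance to any set
    of integer vectors, an infimum of affine functions, is concave. Hence the
    part of the cube where this distance exceeds 1 is convex
    ([d1_set_segment]); so is its trace on a convex set K.

    It remains to pass from a cube to its neighbours. The cubes a and a + e_i
    share a facet, on which [facet_point a i] has i-th coordinate a_i + 1 and
    all others equal to a_j + 1 - s, where s = 3 / (2 (n - 1)). When n >= 4 we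
    have s <= 1/2, so each of the n - 1 coordinates other than the i-th is at
    distance at least s from every integer, and the point is at distance at
    least 3/2 from all of Z^n ([facet_point_far]).

    The facet points are chosen high in the cube so that they also satisfy
    x_j > -1 and sum x_j > -2 as soon as the cube a contains a point satisfying
    these ([halfspace_region_facet]): then a_j + 1 >= 0 for all j, so that the
    coordinate sum is at least -(n - 1) s = -3/2. One can therefore go up from
    any cube, one coordinate at a time, inside the set ([climb]). Two points
    lying in the cubes a and b are both joined in this way to the cube
    max(a, b), and there they are joined to each other by convexity. The same
    argument proves both connectedness claims, with K the whole space or the
    region above.

    For non-emptiness, the centre (1/2, ..., 1/2) of the unit cube is at
    distance n / 2 >= 3/2 from Z^n. *)

(** * Connected components *)

Lemma segment_connected_component (R : realType) (V : normedModType R)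
    (A : set V) (x y : V) :
  (forall t : R, 0 <= t <= 1 -> A (x + t *: (y - x))) ->
  connected_component A x y.
Proof.
move=> sA; pose f (t : R) : V := x + t *: (y - x).
have f0 : f 0 = x by rewrite /f scale0r addr0.
have f1 : f 1 = y by rewrite /f scale1r addrC subrK.
have cf : continuous f.
  move=> t; apply: (@cvgD _ _ _ _ _ (fun=> x)); first exact: cvg_cst.
  exact: scalel_continuous.
apply: (@connected_component_max _ A (f @` `[0, 1])).
- by exists 0 => //=; rewrite in_itv /= lexx ler01.
- by move=> z [t /=]; rewrite in_itv /= => t01 <-; exact: sA.
- apply: connected_continuous_connected; first exact: segment_connected.
  exact: continuous_subspaceT.
- by exists 1 => //=; rewrite in_itv /= lexx ler01.
Qed.

Lemma connected_from_components (T : topologicalType) (A : set T) :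
  (forall x y, A x -> A y -> connected_component A x y) -> connected A.
Proof.
move=> cA; have [->|/set0P[x Ax]] := eqVneq A set0; first exact: connected0.
suff -> : A = connected_component A x by exact: component_connected.
by apply/seteqP; split=> [y Ay|]; [exact: cA|exact: connected_component_sub].
Qed.

Lemma connected_translate (R : realType) (V : normedModType R) (A : set V)
  (u : V) : connected A -> connected [set x | A (x - u)].
Proof.
move=> cA.
have -> : [set x | A (x - u)] = (fun x => x + u) @` A.
  apply/seteqP; split=> [x Ax|_ [x Ax <-] /=]; last by rewrite addrK.
  by exists (x - u) => //; rewrite subrK.
apply: connected_continuous_connected cA _; apply: continuous_subspaceT => x.
by apply: cvgD; [exact: cvg_id|exact: cvg_cst].
Qed.

(** * The distance to a set of integer vectors, cube by cube *)

Definition lattice (R : realType) (n : nat) (M : set 'rV[int]_n) :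
  set 'rV[R]_n := [set map_mx intr m | m in M].
Arguments lattice R {n} M _.

Definition in_cube (R : realType) (n : nat) (a : 'rV[int]_n) (x : 'rV[R]_n) :=
  forall j, (a ord0 j)%:~R <= x ord0 j <= (a ord0 j)%:~R + 1.

Lemma in_cube_floor (R : realType) (n : nat) (x : 'rV[R]_n) :
  in_cube (\row_j Num.floor (x ord0 j)) x.
Proof.
move=> j; rewrite mxE; have /andP[-> /ltW] := floor_itv (x ord0 j).
by rewrite intrD.
Qed.

Lemma d1_ge0 (R : realType) (n : nat) (x y : 'rV[R]_n) : 0 <= d1 x y.
Proof. by apply: sumr_ge0. Qed.

Lemma d1_set_le (R : realType) (n : nat) (A : set 'rV[R]_n) (x m : 'rV[R]_n) :
  A m -> d1_set x A <= d1 x m.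
Proof.
move=> Am; apply: ge_inf; last by exists m.
by exists 0 => _ [w _ <-]; exact: d1_ge0.
Qed.

Lemma d1_set_ge (R : realType) (n : nat) (A : set 'rV[R]_n) (x : 'rV[R]_n)
    (c : R) :
  A !=set0 -> (forall m, A m -> c <= d1 x m) -> c <= d1_set x A.
Proof.
move=> [m Am] cA; apply: lb_le_inf; first by exists (d1 x m), m.
by move=> _ [w Aw <-]; exact: cA.
Qed.

(** A unit cube lies on one side of each hyperplane x_j = m_j with m_j an
    integer, so the absolute values in [d1] can be opened uniformly on it. *)
Lemma d1_cube_affine (R : realType) (n : nat) (a m : 'rV[int]_n)
    (x y : 'rV[R]_n) (t : R) : 0 <= t <= 1 -> in_cube a x -> in_cube a y ->
  d1 (x + t *: (y - x)) (map_mx intr m)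
    = (1 - t) * d1 x (map_mx intr m) + t * d1 y (map_mx intr m).
Proof.
move=> t01 ax ay; rewrite /d1 /l1norm !mulr_sumr -big_split /=.
apply: eq_bigr => j _; have := ax j; have := ay j; rewrite !mxE.
move: (x ord0 j) (y ord0 j) => u v av au.
have [mj|mj] := leP (m ord0 j) (a ord0 j).
  have mja : (m ord0 j)%:~R <= (a ord0 j)%:~R :> R by rewrite ler_int.
  by rewrite !ger0_norm; [ring|nra..].
have mja : (a ord0 j)%:~R + 1 <= (m ord0 j)%:~R :> R.
  by rewrite -[1]/(1%:~R) -intrD ler_int lezD1.
by rewrite !ler0_norm; [ring|nra..].
Qed.

(** An infimum of affine functions is concave, and superlevel sets of concave
    functions are convex. *)
Lemma d1_set_segment (R : realType) (n : nat) (M : set 'rV[int]_n)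
    (a : 'rV[int]_n) (x y : 'rV[R]_n) (c t : R) :
  M !=set0 -> 0 <= t <= 1 -> in_cube a x -> in_cube a y ->
  c < d1_set x (lattice R M) -> c < d1_set y (lattice R M) ->
  c < d1_set (x + t *: (y - x)) (lattice R M).
Proof.
move=> [m0 Mm0] t01 ax ay cx cy.
(* The pointwise bound [c < d1 z m] for all [m] would only give a weak bound
   on the infimum; the smaller of the two distances leaves a margin above [c]. *)
pose e := Num.min (d1_set x (lattice R M)) (d1_set y (lattice R M)).
apply: (@lt_le_trans _ _ e); first by rewrite lt_min cx.
apply: d1_set_ge; first by exists (map_mx intr m0), m0.
move=> _ [m Mm <-]; rewrite (d1_cube_affine _ t01 ax ay).
have Lm : lattice R M (map_mx intr m) by exists m.
have ex : e <= d1 x (map_mx intr m).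
  by rewrite /e ge_min d1_set_le.
have ey : e <= d1 y (map_mx intr m).
  by rewrite /e ge_min d1_set_le ?orbT.
by nra.
Qed.

(** * A far point on each facet *)

Lemma int_dist_ge (R : realType) (k m : int) (s : R) : 0 <= s <= 2^-1 ->
  s <= `|k%:~R - s - m%:~R|.
Proof.
move=> s01; have [km|km] := leP k m.
  have kmR : k%:~R <= m%:~R :> R by rewrite ler_int.
  by rewrite ler0_norm; lra.
have kmR : m%:~R + 1 <= k%:~R :> R by rewrite -[1]/(1%:~R) -intrD ler_int lezD1.
by rewrite ger0_norm; lra.
Qed.

(** A point common to the cubes [a] and [a + e_i], chosen near the top vertex
    [a + 1] to keep its coordinates large; the total gap to that vertex is 3/2,
    a value between the 1 required for the distance and the 2 allowed by the
    condition on the coordinate sum. *)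
Definition facet_point (R : realType) (n : nat) (a : 'rV[int]_n) (i : 'I_n) :
  'rV[R]_n :=
  \row_j ((a ord0 j + 1)%:~R - (if j == i then 0 else 3 / 2 / n.-1%:R)).

(** This is where dimension at least 4 is used: a gap of at most 1/2 is what
    makes [a_j + 1] the nearest integer. *)
Lemma facet_gap_itv (R : realType) (n : nat) : (4 <= n)%N ->
  0 <= (3 / 2 / n.-1%:R : R) <= 2^-1.
Proof.
case: n => [//|n] /=; rewrite ltnS => n3.
have n3R : 3 <= n%:R :> R by rewrite (ler_nat R 3).
by rewrite divr_ge0 ?ler_pdivrMr //=; lra.
Qed.

Lemma sum_facet_gap (R : realType) (n : nat) (i : 'I_n) : (2 <= n)%N ->
  \sum_(j < n) (if j == i then 0 else 3 / 2 / n.-1%:R) = 3 / 2 :> R.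
Proof.
move=> n2; rewrite (bigD1 i) //= eqxx add0r.
rewrite (eq_bigr (fun=> 3 / 2 / n.-1%:R)); last by move=> j /negPf ->.
rewrite sumr_const cardC1 card_ord -[LHS]mulr_natr divfK //.
by rewrite pnatr_eq0; case: n n2 i => [|[]].
Qed.

Lemma facet_point_in_cube (R : realType) (n : nat) (a : 'rV[int]_n) (i : 'I_n) :
  (4 <= n)%N -> in_cube a (facet_point R a i).
Proof.
by move=> /(facet_gap_itv R) ? j; rewrite !mxE intrD; case: eqP => _; lra.
Qed.

Lemma facet_point_in_next_cube (R : realType) (n : nat) (a : 'rV[int]_n)
    (i : 'I_n) :
  (4 <= n)%N -> in_cube (a + delta_mx ord0 i) (facet_point R a i).
Proof.
move=> /(facet_gap_itv R) ? j; rewrite !mxE eqxx /= !intrD.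
by case: eqP => _ /=; lra.
Qed.

Lemma facet_point_far (R : realType) (n : nat) (a m : 'rV[int]_n) (i : 'I_n) :
  (4 <= n)%N -> 3 / 2 <= d1 (facet_point R a i) (map_mx intr m).
Proof.
move=> n4; rewrite -[leLHS](sum_facet_gap R i); last exact: leq_trans n4.
apply: ler_sum => j _; rewrite !mxE; apply: int_dist_ge.
by have := facet_gap_itv R n4; case: eqP => _; lra.
Qed.

(** * Connectedness inside a convex set *)

Section FarInConvex.
Variables (R : realType) (n : nat) (M : set 'rV[int]_n) (K : set 'rV[R]_n).
Hypothesis n4 : (4 <= n)%N.
Hypothesis M0 : M !=set0.
Hypothesis convK : forall x y (t : R),
  0 <= t <= 1 -> K x -> K y -> K (x + t *: (y - x)).
(** Since [facet_point R a i] also lies in the cube [a + e_i], this condition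
    propagates by itself to all cubes above one that meets [K]. *)
Hypothesis facetK : forall a i x, K x -> in_cube a x -> K (facet_point R a i).

Let W := [set x | 1 < d1_set x (lattice R M) /\ K x].

Lemma cube_joined a x y : W x -> W y -> in_cube a x -> in_cube a y ->
  connected_component W x y.
Proof using M0 convK.
move=> [fx Kx] [fy Ky] ax ay; apply: segment_connected_component => t t01.
split; last exact: convK.
exact: (d1_set_segment M0 t01 ax ay).
Qed.

Lemma facet_point_far_in_convex a i x :
  W x -> in_cube a x -> W (facet_point R a i).
Proof using n4 M0 facetK.
move=> [_ Kx] ax; split; last exact: facetK ax.
apply: (@lt_le_trans _ _ (3 / 2)); first by lra.
have [m0 Mm0] := M0; apply: d1_set_ge; first by exists (map_mx intr m0), m0.
by move=> _ [m _ <-]; exact: facet_point_far.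
Qed.

(** Crossing facets upwards, one unit step at a time: the induction is on the
    number [d] of steps from the cube [a] to the cube [c]. *)
Lemma climb (d : nat) (a c : 'rV[int]_n) (x : 'rV[R]_n) :
  (forall j, a ord0 j <= c ord0 j) ->
  \sum_j (c ord0 j - a ord0 j) = d%:Z -> W x -> in_cube a x ->
  exists2 z, in_cube c z & connected_component W x z.
Proof using n4 M0 convK facetK.
elim: d a x => [|d IHd] a x ac cad Wx ax.
  have ca0 : a = c.
    apply/rowP => j; apply/esym/eqP; rewrite -subr_eq0; apply/eqP.
    by apply: (psumr_eq0P _ cad) => // k _; rewrite subr_ge0.
  by exists x; [rewrite -ca0|exact: connected_component_refl].
have [i aci] : exists i, a ord0 i < c ord0 i.
  apply/existsP; apply: contra_eqT cad => /existsPn nac.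
  rewrite big1 // => j _; apply/eqP; rewrite subr_eq0 eq_le ac andbT.
  by rewrite leNgt nac.
have Wy := facet_point_far_in_convex i Wx ax.
have [||||z cz yz] := IHd (a + delta_mx ord0 i) (facet_point R a i) => //.
- by move=> j; rewrite !mxE eqxx /=; have := ac j; case: eqP => [->|_] /=; lia.
- rewrite (eq_bigr (fun j => (c ord0 j - a ord0 j) - (j == i)%:R)).
    rewrite sumrB cad (bigD1 i) //= eqxx big1; last by move=> j /negPf ->.
    by rewrite addr0 intS [1 + _]addrC addrK.
  by move=> j _; rewrite !mxE eqxx /= opprD addrA.
- exact: facet_point_in_next_cube.
exists z => //; apply: connected_component_trans yz.
by apply: cube_joined ax _ => //; exact: facet_point_in_cube.
Qed.

(** The cubes are only ever left upwards, which suffices because any two of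
    them have a common upper bound. *)
Lemma connected_far_in_convex : connected W.
Proof using n4 M0 convK facetK.
apply: connected_from_components => x y Wx Wy.
set a := \row_j Num.floor (x ord0 j); set b := \row_j Num.floor (y ord0 j).
pose c : 'rV[int]_n := \row_j Num.max (a ord0 j) (b ord0 j).
have up (a' : 'rV[int]_n) x' : (forall j, a' ord0 j <= c ord0 j) -> W x' ->
    in_cube a' x' -> exists2 z, in_cube c z & connected_component W x' z.
  move=> a'c; pose s := \sum_j (c ord0 j - a' ord0 j).
  apply: (@climb `|s|%N) => //.
  by rewrite gez0_abs // sumr_ge0 // => j _; rewrite subr_ge0.
have [|z cz xz] := up a x _ Wx (in_cube_floor x).
  by move=> j; rewrite [leRHS]mxE le_max lexx.
have [|w cw yw] := up b y _ Wy (in_cube_floor y).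
  by move=> j; rewrite [leRHS]mxE le_max lexx orbT.
apply: (connected_component_trans xz).
apply: connected_component_trans (connected_component_sym yw).
have Wz : W z := connected_component_sub xz.
have Ww : W w := connected_component_sub yw.
exact: cube_joined cz cw.
Qed.

End FarInConvex.

(** * Non-emptiness *)

Lemma oddZn_neq0 (n : nat) : (0 < n)%N -> oddZn n !=set0.
Proof.
case: n => // n _; exists (delta_mx ord0 ord0).
rewrite /oddZn /= /l1norm (bigD1 ord0) //= big1 ?mxE // => j /negPf j0.
by rewrite mxE j0 andbF.
Qed.

Lemma far_pos_set_centre (R : realType) (n : nat) :
  (3 <= n)%N -> far_pos_set R n (const_mx (3 / 2)).
Proof.
move=> n3; have n3R : 3 <= n%:R :> R by rewrite (ler_nat R 3).
split.
- apply: (@lt_le_trans _ _ (3 / 2)); first by lra.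
  have [m0 Mm0] := oddZn_neq0 (leq_trans (isT : 0 < 3)%N n3).
  apply: d1_set_ge; first by exists (map_mx intr m0), m0.
  move=> _ [m _ <-]; apply: (@le_trans _ _ (\sum_(j < n) 2^-1)).
    by rewrite sumr_const card_ord -mulr_natr; lra.
  apply: ler_sum => j _; rewrite !mxE.
  have -> : 3 / 2 - 1 - (m ord0 j)%:~R = 1%:~R - 2^-1 - (m ord0 j)%:~R :> R.
    by rewrite -[1%:~R]/1; lra.
  by apply: int_dist_ge; lra.
- by move=> i; rewrite mxE; lra.
- rewrite (eq_bigr (fun=> 2^-1)); last by move=> j _; rewrite mxE; lra.
  by rewrite sumr_const card_ord -mulr_natr; lra.
Qed.

(** * The positivity conditions *)

(** In the coordinates x = theta - 1. *)
Definition halfspace_region (R : realType) (n : nat) : set 'rV[R]_n :=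
  [set x | (forall i, -1 < x ord0 i) /\ -2 < \sum_i x ord0 i].

Lemma convex_comb_gt (R : realType) (c u v t : R) :
  0 <= t <= 1 -> c < u -> c < v -> c < (1 - t) * u + t * v.
Proof.
move=> t01 cu cv; pose e := Num.min u v.
have ce : c < e by rewrite lt_min cu.
have eu : e <= u by rewrite ge_min lexx.
have ev : e <= v by rewrite ge_min lexx orbT.
nra.
Qed.

Lemma halfspace_region_convex (R : realType) (n : nat) (x y : 'rV[R]_n) (t : R) :
  0 <= t <= 1 -> halfspace_region x -> halfspace_region y ->
  halfspace_region (x + t *: (y - x)).
Proof.
move=> t01 [x1 x2] [y1 y2]; split=> [i|].
  rewrite !mxE; have := convex_comb_gt t01 (x1 i) (y1 i); lra.
have -> : \sum_i (x + t *: (y - x)) ord0 i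
    = (1 - t) * (\sum_i x ord0 i) + t * (\sum_i y ord0 i).
  rewrite !mulr_sumr -big_split; apply: eq_bigr => i _; rewrite !mxE /=; ring.
exact: convex_comb_gt.
Qed.

(** A cube meeting the region has [a_j + 1 >= 0] for all [j] by integrality, so
    its top vertex has nonnegative coordinates; the facet point differs from
    that vertex by at most 1/2 in each coordinate and by 3/2 in total. *)
Lemma halfspace_region_facet (R : realType) (n : nat) (a : 'rV[int]_n) (i : 'I_n)
    (x : 'rV[R]_n) : (4 <= n)%N -> halfspace_region x -> in_cube a x ->
  halfspace_region (facet_point R a i).
Proof.
move=> n4 [x1 _] ax; have h := facet_gap_itv R n4.
have a1 j : 0 <= (a ord0 j + 1)%:~R :> R.
  rewrite ler0z; have : -1%:~R < (a ord0 j + 1)%:~R :> R.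
    by have := x1 j; have := ax j; rewrite intrD; lra.
  by rewrite -intrN ltr_int; lia.
split=> [j|].
  by rewrite mxE; have := a1 j; case: eqP => _; lra.
rewrite (eq_bigr _ (fun j _ => mxE _ _ _ _)) sumrB.
rewrite sum_facet_gap; last exact: leq_trans n4.
have := @sumr_ge0 _ _ (index_enum 'I_n) predT _ (fun j _ => a1 j); lra.
Qed.

Theorem lemma2 (R : realType) (n : nat) :
  [/\ (3 <= n)%N -> far_set R n !=set0,
      (4 <= n)%N -> connected (far_set R n),
      (3 <= n)%N -> far_pos_set R n !=set0 &
      (4 <= n)%N -> connected (far_pos_set R n)].
Proof.
split=> [n3|n4|n3|n4].
- by exists (const_mx (3 / 2)); have [] := far_pos_set_centre R n3.
- have M0 : oddZn n !=set0 by apply: oddZn_neq0; exact: leq_trans n4.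
  have := @connected_far_in_convex R n _ setT n4 M0 (fun _ _ _ _ _ _ => I)
    (fun _ _ _ _ _ => I).
  move=> /(@connected_translate _ _ _ (const_mx 1)).
  congr connected; apply/seteqP; split=> x /=; first by case.
  by split.
- by exists (const_mx (3 / 2)); exact: far_pos_set_centre.
- have M0 : oddZn n !=set0 by apply: oddZn_neq0; exact: leq_trans n4.
  have := @connected_far_in_convex R n _ (@halfspace_region R n) n4 M0
    (@halfspace_region_convex R n)
    (fun a i x Kx ax => halfspace_region_facet i n4 Kx ax).
  move=> /(@connected_translate _ _ _ (const_mx 1)).
  congr connected; apply/seteqP; split=> x /=.
    move=> [fx [x1 x2]]; split => // [i|].
      by have := x1 i; rewrite !mxE; lra.
    by apply: lt_le_trans x2 _; apply: ler_sum => i _; rewrite !mxE.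
  move=> [fx x1 x2]; split=> //; split=> [i|].
    by have := x1 i; rewrite !mxE; lra.
  by apply: lt_le_trans x2 _; apply: ler_sum => i _; rewrite !mxE.
Qed.
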